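(* Let $(A,\cdot,[\cdot,\cdot])$ be an almost Poisson algebra and $(V,\mu,\rho)$ a representation of it. A linear map $\mathcal{K}:V\to A$ is a relative averaging operator on $(A,\cdot,[\cdot,\cdot])$ with respect to $(V,\mu,\rho)$ if and only if the graph $\mathrm{Gr}(\mathcal{K})=\{\mathcal{K}(u)+u\mid u\in V\}$ is an algebra with bracket subalgebra of the hemisemi-direct product $A\oplus_{\mu,\rho}V$.
   Context: All vector spaces are finite dimensional over a field $\mathbb{K}$ of characteristic zero. An almost Poisson algebra $(A,\cdot,[\cdot,\cdot])$ is a vector space with a commutative associative bilinear product $\cdot$ and a skew-symmetric bilinear bracket satisfying $[x,y\cdot z]=[x,y]\cdot z+y\cdot[x,z]$ (no Jacobi identity is assumed). A representation $(V,\mu,\rho)$ of it is a vector space $V$ with linear maps $\mu,\rho:A\to\mathrm{End}(V)$ such that $\mu(x\cdot y)=\mu(x)\mu(y)$, $\rho(x\cdot y)=\mu(y)\rho(x)+\mu(x)\rho(y)$ and $\mu([x,y])=\rho(x)\mu(y)-\mu(y)\rho(x)$ for all $x,y\in A$. A relative averaging operator on $(A,\cdot,[\cdot,\cdot])$ with respect to $(V,\mu,\rho)$ is a linear map $\mathcal{K}:V\to A$ such that for all $u,v\in V$: $\mathcal{K}(u)\cdot\mathcal{K}(v)=\mathcal{K}(\mu(\mathcal{K}(u))v)$ and $[\mathcal{K}(u),\mathcal{K}(v)]=\mathcal{K}(\rho(\mathcal{K}(u))v)$. An $\mathsf{AWB}$ (algebra with bracket) $(B,\cdot,\{\cdot,\cdot\})$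 is an associative algebra with a bilinear bracket satisfying $\{x,y\cdot z\}=\{x,y\}\cdot z+y\cdot\{x,z\}$. An algebra with bracket subalgebra is a linear subspace closed under both the product and the bracket. The hemisemi-direct product $A\oplus_{\mu,\rho}V$ is the $\mathsf{AWB}$ on the vector space $A\oplus V$ with operations $(x+u)\cdot_{A\oplus V}(y+v)=x\cdot y+\mu(x)v$ and $\{x+u,y+v\}_{A\oplus V}=[x,y]+\rho(x)v$ for $x,y\in A$, $u,v\in V$. *)

(* Defs.v *)
From HB Require Import structures.
From mathcomp Require Import all_boot all_order all_algebra.

Set Implicit Arguments.
Unset Strict Implicit.
Unset Printing Implicit Defensive.

Import GRing.Theory.
Local Open Scope ring_scope.

(* Products are only required to be associative, not unital, so they cannot be
   taken from the algType hierarchy: they are bilinear maps bundled in records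
   over a finite-dimensional space. *)

Record almost_poisson (K : fieldType) (A : vectType K) := AlmostPoisson {
  ap_mul : {bilinear A -> A -> A};
  ap_br : {bilinear A -> A -> A};
  ap_mulA : forall x y z, ap_mul x (ap_mul y z) = ap_mul (ap_mul x y) z;
  ap_mulC : forall x y, ap_mul x y = ap_mul y x;
  ap_brN : forall x y, ap_br x y = - ap_br y x;
  ap_leibniz : forall x y z,
    ap_br x (ap_mul y z) = ap_mul (ap_br x y) z + ap_mul y (ap_br x z)
}.

Record ap_representation (K : fieldType) (A : vectType K)
    (P : almost_poisson A) (V : vectType K) := APRepresentation {
  rep_mu : 'Hom(A, 'End(V));
  rep_rho : 'Hom(A, 'End(V));
  rep_mu_mul : forall x y,
    rep_mu (ap_mul P x y) = (rep_mu x \o rep_mu y)%VF;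
  rep_rho_mul : forall x y,
    rep_rho (ap_mul P x y)
    = (rep_mu y \o rep_rho x)%VF + (rep_mu x \o rep_rho y)%VF;
  rep_mu_br : forall x y,
    rep_mu (ap_br P x y)
    = (rep_rho x \o rep_mu y)%VF - (rep_mu y \o rep_rho x)%VF
}.

Definition relative_averaging (K : fieldType) (A V : vectType K)
    (P : almost_poisson A) (M : ap_representation P V) (k : 'Hom(V, A)) : Prop :=
  forall u v : V,
    ap_mul P (k u) (k v) = k (rep_mu M (k u) v) /\
    ap_br P (k u) (k v) = k (rep_rho M (k u) v).

Record awb (K : fieldType) (B : vectType K) := AWB {
  awb_mul : {bilinear B -> B -> B};
  awb_br : {bilinear B -> B -> B};
  awb_mulA : forall x y z, awb_mul x (awb_mul y z) = awb_mul (awb_mul x y) z;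
  awb_leibniz : forall x y z,
    awb_br x (awb_mul y z) = awb_mul (awb_br x y) z + awb_mul y (awb_br x z)
}.

Definition awb_subalgebra (K : fieldType) (B : vectType K) (Q : awb B)
    (S : B -> Prop) : Prop :=
  [/\ exists W : {vspace B}, forall x, S x <-> x \in W,
      forall x y, S x -> S y -> S (awb_mul Q x y)
    & forall x y, S x -> S y -> S (awb_br Q x y)].

Section Hemisemidirect.

Variables (K : fieldType) (A V : vectType K).

(* The external direct sum of A and V is the product vector space A * V, where
   the vector x + u is the pair (x, u). *)

Definition hemi_op (f : {bilinear A -> A -> A}) (h : 'Hom(A, 'End(V)))
    (a b : (A * V)%type) : (A * V)%type := (f a.1 b.1, h a.1 b.2).

Lemma hemi_op_bilinear f h : bilinear_for *:%R *:%R (hemi_op f h).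
Proof.
split=> c k a b; rewrite /hemi_op /=; congr (_, _).
- by rewrite linearPl.
- by rewrite linearP add_lfunE scale_lfunE.
- by rewrite linearPr.
- by rewrite linearP.
Qed.

HB.instance Definition _ f h :=
  bilinear_isBilinear.Build K _ _ _ *:%R *:%R (hemi_op f h)
    (hemi_op_bilinear f h).

Variables (P : almost_poisson A) (M : ap_representation P V).

Lemma hemi_mulA a b c :
  let m := hemi_op (ap_mul P) (rep_mu M) in m a (m b c) = m (m a b) c.
Proof.
by rewrite /= /hemi_op /= ap_mulA rep_mu_mul comp_lfunE.
Qed.

Lemma hemi_leibniz a b c :
  let m := hemi_op (ap_mul P) (rep_mu M) in
  let br := hemi_op (ap_br P) (rep_rho M) in
  br a (m b c) = m (br a b) c + m b (br a c).
Proof.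
rewrite /= /hemi_op /= ap_leibniz rep_mu_br; congr (_, _).
by rewrite /= add_lfunE opp_lfunE !comp_lfunE subrK.
Qed.

Definition hemisemidirect : awb (A * V)%type :=
  @AWB K (A * V)%type (hemi_op (ap_mul P) (rep_mu M))
    (hemi_op (ap_br P) (rep_rho M)) hemi_mulA hemi_leibniz.

End Hemisemidirect.

Definition graph (K : fieldType) (A V : vectType K) (k : 'Hom(V, A)) :
    (A * V)%type -> Prop :=
  fun z => exists u : V, z = (k u, u).

(* Main.v *)
Require Import Defs.
From HB Require Import structures.
From mathcomp Require Import all_boot all_order all_algebra.

(** A pair [(a, u)] lies on the graph of [k] exactly when [a = k u].  The
    operations of the hemisemi-direct product act on the second component by
    [mu] and [rho] evaluated at the first component of the left factor, so the
    product of the graph points over [u] and [v] is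
    [(k u * k v, mu (k u) v)].  It is again a graph point precisely when
    [k u * k v = k (mu (k u) v)], the first averaging identity; the bracket
    gives the second one in the same way ([hemi_op_graphP]).  What remains is
    that the graph is a linear subspace, which holds for every linear [k]
    because it is the image of [V] under the linear map [u |-> (k u, u)]
    ([graph_vspace]). *)

Local Open Scope ring_scope.

Import GRing.Theory.

Section Graph.

Variables (K : fieldType) (A V : vectType K) (k : 'Hom(V, A)).

Definition graph_embed (u : V) : (A * V)%type := (k u, u).

Lemma graph_embed_linear : linear graph_embed.
Proof. by move=> c u v; rewrite /graph_embed linearP. Qed.

HB.instance Definition _ :=
  GRing.isLinear.Build K V (A * V)%type *:%R graph_embed graph_embed_linear.

Lemma graph_vspace : exists W : {vspace (A * V)%type},
  forall z, graph k z <-> z \in W.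
Proof.
exists (limg (linfun graph_embed)) => z; split.
- case=> u ->; have -> : (k u, u) = linfun graph_embed u by rewrite lfunE.
  exact/memv_img/memvf.
- by case/memv_imgP=> u _ ->; exists u; rewrite lfunE.
Qed.

(** A graph point is determined by its second component, so closure of the
    graph under one operation of the hemisemi-direct product forces, and
    follows from, one identity between first components.  Stating it for an
    arbitrary operation [f] and action [h] covers both the product and the
    bracket. *)
Lemma hemi_op_graphP (f : {bilinear A -> A -> A}) (h : 'Hom(A, 'End(V))) :
  (forall x y, graph k x -> graph k y -> graph k (hemi_op f h x y)) <->
  (forall u v, f (k u) (k v) = k (h (k u) v)).
Proof.
split=> [clos u v | kf _ _ [u ->] [v ->]].
- have [|| w [-> ->] //] := clos (k u, u) (k v, v); by [exists u | exists v].
- by exists (h (k u) v); rewrite /hemi_op /= kf.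
Qed.

End Graph.

Theorem theorem5p17 (K : fieldType) (charK0 : [pchar K] =i pred0)
    (A : vectType K) (P : almost_poisson A)
    (V : vectType K) (M : ap_representation P V) (k : 'Hom(V, A)) :
  relative_averaging M k <-> awb_subalgebra (hemisemidirect M) (graph k).
Proof.
split=> [avg | [_ clos_mul clos_br] u v].
- split; first exact: graph_vspace.
  + by apply/(hemi_op_graphP _ _ _ k (ap_mul P) (rep_mu M)) => u v; case: (avg u v).
  + by apply/(hemi_op_graphP _ _ _ k (ap_br P) (rep_rho M)) => u v; case: (avg u v).
- split.
  + exact: (proj1 (hemi_op_graphP _ _ _ k (ap_mul P) (rep_mu M)) clos_mul).
  + exact: (proj1 (hemi_op_graphP _ _ _ k (ap_br P) (rep_rho M)) clos_br).
Qed.
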